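(* Let $M\in\mathbb N$. If $q\in\mathcal I$ (with $\mathcal I\subset\overline{\mathcal U}$ understood, i.e. $q\in\mathcal I\cap\overline{\mathcal U}$), then $(\mathbf V_q,\sigma)$ is a topologically mixing subshift.
   Context: Notation. $\Sigma_M=\{0,\dots,M\}^{\mathbb N}$ with the product topology; $\sigma$ is the one-sided shift; $\prec,\preccurlyeq$ denote the lexicographic order. The reflection of a sequence or word replaces each symbol $x_i$ by $M-x_i$ and is denoted by an overline. For a word $w=w_1\dots w_n$, $w^-=w_1\dots w_{n-1}(w_n-1)$ (if $w_n>0$), $w^+=w_1\dots w_{n-1}(w_n+1)$ (if $w_n<M$), and $w^\infty$ is the infinite concatenation. For $q\in(1,M+1]$, $\alpha(q)\in\Sigma_M$ is the quasi-greedy expansion of $1$ in base $q$: the lexicographically largest $(a_i)\in\Sigma_M$ with infinitely many non-zero terms and $\sum_i a_iq^{-i}=1$. $\mathbf V=\{a\in\Sigma_M:\overline a\preccurlyeq\sigma^n(a)\preccurlyeq a\ \forall n\ge0\}$, $\mathcal V=\{q\in(1,M+1]:\alpha(q)\in\mathbf V\}$, $\overline{\mathcal U}=\{q\in(1,M+1]:\overline{\alpha(q)}\prec\sigma^n(\alpha(q))\preccurlyeq\alpha(q)\ \forall n\ge0\}$, $\mathbf V_q=\{\mathbf x\in\Sigma_M:\overline{\alpha(q)}\preccurlyeq\sigma^n(\mathbf x)\preccurlyeq\alpha(q)\ \forall n\ge0\}$. A sequence $a\in\mathbf V$ is irreducible if $a_1\dots a_j(\overline{a_1\dots a_j}^{\,+})^\infty\prec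 a$ whenever $(a_1\dots a_j^-)^\infty\in\mathbf V$. $\mathcal I=\{q\in\mathcal V:\alpha(q)\text{ irreducible}\}$. A subshift $(X,\sigma)$ with language $\mathcal L(X)$ (all finite factors of elements of $X$) is topologically mixing if for all $\upsilon,\nu\in\mathcal L(X)$ there is $N\in\mathbb N$ such that for every $n\ge N$ there is a word $\omega\in\mathcal L(X)$ of length $n$ with $\upsilon\omega\nu\in\mathcal L(X)$. *)

(* Defs.v *)
From HB Require Import structures.
From mathcomp Require Import all_boot all_order all_algebra.
From mathcomp Require Import all_classical all_reals all_analysis.

Set Implicit Arguments.
Unset Strict Implicit.
Unset Printing Implicit Defensive.

Import Order.TTheory GRing.Theory Num.Theory.
Import numFieldNormedType.Exports.

Local Open Scope classical_set_scope.
Local Open Scope ring_scope.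

(* Sequences are indexed from 0: the term written x_i in 1-based notation is
   x (i - 1).  The order is lexicographic, and the topology is the product of
   the discrete topologies on the alphabet {0, ..., M}. *)
Definition Sigma (M : nat) : Type := nat -> 'I_M.+1.

HB.instance Definition _ (M : nat) :=
  Order.Total.copy (Sigma M) (big_lexi_order (fun _ : nat => 'I_M.+1)).
HB.instance Definition _ (M : nat) :=
  Topological.copy (Sigma M)
    (prod_topology (fun _ : nat => discrete_topology 'I_M.+1)).

Definition shift_seq M (x : Sigma M) : Sigma M := fun i => x i.+1.

(* rev_ord maps the symbol d of {0, ..., M} to M - d. *)
Definition reflect_seq M (x : Sigma M) : Sigma M := fun i => rev_ord (x i).
Definition reflect_word M (w : seq 'I_M.+1) : seq 'I_M.+1 := map (@rev_ord _) w.

Definition prefix_of M (x : Sigma M) (j : nat) : seq 'I_M.+1 := mkseq x j.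

(* w^- and w^+: meaningful only when w is nonempty and its last symbol is
   respectively > 0 and < M; the other values are junk. *)
Definition word_minus M (w : seq 'I_M.+1) : seq 'I_M.+1 :=
  if w is d :: s then rcons (belast d s) (inord (last d s).-1) else [::].
Definition word_plus M (w : seq 'I_M.+1) : seq 'I_M.+1 :=
  if w is d :: s then rcons (belast d s) (inord (last d s).+1) else [::].

(* w^oo, for w nonempty *)
Definition word_periodic M (w : seq 'I_M.+1) : Sigma M :=
  fun i => nth ord0 w (i %% size w)%N.

Definition word_cat M (w : seq 'I_M.+1) (x : Sigma M) : Sigma M :=
  fun i => if (i < size w)%N then nth ord0 w i else x (i - size w)%N.

Definition infinite_expansions (R : realType) M (q : R) : set (Sigma M) :=
  [set a : Sigma M | (forall n, exists2 m, (n <= m)%N & a m != ord0) /\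
           series (fun i => (a i)%:R / q ^+ i.+1) @ \oo --> (1 : R)].

Arguments infinite_expansions {R} M q.

(* The default value 0^oo would only be taken if there were no lexicographically
   largest infinite expansion, which does not happen for 1 < q <= M + 1. *)
Definition alpha (R : realType) M (q : R) : Sigma M :=
  xget (fun=> ord0) [set a : Sigma M | infinite_expansions M q a /\
    forall b : Sigma M, infinite_expansions M q b -> (b <= a)%O].

Definition boldV M : set (Sigma M) :=
  [set a : Sigma M | forall n, (reflect_seq a <= iter n (@shift_seq M) a <= a)%O].

Definition calV (R : realType) M : set R :=
  [set q | 1 < q <= M.+1%:R /\ boldV (alpha M q)].

Definition Ubar (R : realType) M : set R :=
  [set q | 1 < q <= M.+1%:R /\
    forall n, (reflect_seq (alpha M q) < iter n (@shift_seq M) (alpha M q)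
                 <= alpha M q)%O].

Definition boldVq (R : realType) M (q : R) : set (Sigma M) :=
  [set x : Sigma M | forall n, (reflect_seq (alpha M q) <= iter n (@shift_seq M) x
                        <= alpha M q)%O].

Arguments boldVq {R} M q.

(* j >= 1 ranges over the lengths with a_j > 0, i.e. those for which
   a_1 ... a_j^- exists; then M - a_j < M, so the word_plus below exists too. *)
Definition irreducible_seq M (a : Sigma M) : Prop :=
  boldV a /\
  forall j, (0 < j)%N -> (0 < a j.-1)%N ->
    boldV (word_periodic (word_minus (prefix_of a j))) ->
    (word_cat (prefix_of a j)
       (word_periodic (word_plus (reflect_word (prefix_of a j)))) < a)%O.

Definition calI (R : realType) M : set R :=
  [set q | calV M q /\ irreducible_seq (alpha M q)].

Definition subshift M (X : set (Sigma M)) : Prop :=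
  closed X /\ (@shift_seq M) @` X `<=` X.

Definition language M (X : set (Sigma M)) : set (seq 'I_M.+1) :=
  [set w | exists2 x, X x &
     exists n, w = mkseq (fun i => x (n + i)%N) (size w)].

Definition topologically_mixing M (X : set (Sigma M)) : Prop :=
  forall u v, language X u -> language X v ->
    exists N, forall n, (N <= n)%N ->
      exists w, [/\ size w = n, language X w & language X (u ++ w ++ v)].

(* Main.v *)
(** A word is read by an automaton whose state consists of two counters: the
    length l of its longest suffix that is a prefix of α = α(q), and the length
    k of its longest suffix that is a prefix of the reflection of α.  Since the
    shifts of α are at most α, a symbol that deviates legally from the
    prediction of a counter resets this counter to 0, and a sequence is in V_q
    iff every symbol of it is legal for both counters.

    Since no shift of α is its own reflection, one of the counters eventually
    vanishes along any sequence of V_q; by reflection, let it be l.  In state (k, 0) no suffix of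
    reflected α_1 ... α_k is a prefix of α, so (α_1 ... α_k^-)^∞ is in V;
    irreducibility says exactly that this sequence may be read from (k, 0), and
    reading it leads to a state (k', 0) with k' < k.  Iterating, one arrives at
    (0, 0) when α_1 and its reflection differ by at least 2, and otherwise at
    (0, 0) or (1, 0), hence at (1, 0) after at most one more symbol.  In the first case a symbol strictly between the two gives
    a loop of length 1 at (0, 0); in the second case there are a loop of length
    2 and, by irreducibility for j = 2, a loop of odd length at (1, 0).  From
    there every sequence of V_q can be entered. *)
Require Import Defs.
From mathcomp Require Import all_boot all_order all_algebra.
From mathcomp Require Import all_classical all_reals all_analysis.
From mathcomp Require Import zify.

Set Implicit Arguments.
Unset Strict Implicit.
Unset Printing Implicit Defensive.

Import Order.TTheory.

Local Open Scope classical_set_scope.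

(** * Lexicographic comparison and reflection *)

Lemma leq_first_diff (M : nat) (x y : Sigma M) (n : nat) :
  (x <= y)%O -> (forall i, i < n -> x i = y i) -> (x n <= y n).
Proof.
move=> + eqxy; case: (eqVneq (x n) (y n)) => [-> //|neq].
have /first_diff_SomeP E : same_prefix n x y /\ x n != y n by [].
by rewrite [(x <= y)%O]/(big_lexi_le _ _ _) /big_lexi_le E leEord.
Qed.

Lemma lexi_leP (M : nat) (x y : Sigma M) :
  (forall n, (forall i, i < n -> x i = y i) -> (x n <= y n)) ->
  (x <= y)%O.
Proof.
move=> xy; rewrite [(x <= y)%O]/(big_lexi_le _ _ _) /big_lexi_le.
case E : first_diff => [n|//].
by have /first_diff_SomeP[eqxy _] := E; rewrite leEord; apply: xy.
Qed.

Lemma lexi_ltP (M : nat) (x y : Sigma M) : (x < y)%O ->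
  exists2 n, (forall i, i < n -> x i = y i) & (x n < y n).
Proof.
rewrite lt_neqAle => /andP[neq xy].
case E : (first_diff x y) => [n|]; last first.
  by move/first_diff_NoneP: E neq => ->; rewrite eqxx.
have /first_diff_SomeP[eqxy neqn] := E.
exists n => //; rewrite ltn_neqAle (leq_first_diff xy eqxy) andbT.
by apply: contra neqn => /eqP/val_inj->.
Qed.

Lemma iter_shiftE (M n : nat) (x : Sigma M) (i : nat) :
  iter n (@shift_seq M) x i = x (n + i).
Proof. by elim: n i => //= n IH i; rewrite /shift_seq IH addnS. Qed.

Lemma iter_shift_reflect (M n : nat) (x : Sigma M) :
  iter n (@shift_seq M) (reflect_seq x) = reflect_seq (iter n (@shift_seq M) x).
Proof. by apply/funext => i; rewrite /reflect_seq !iter_shiftE. Qed.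

Lemma reflect_seqK (M : nat) : involutive (@reflect_seq M).
Proof. by move=> x; apply/funext => i; rewrite /reflect_seq rev_ordK. Qed.

Lemma reflect_wordK (M : nat) : involutive (@reflect_word M).
Proof. exact/mapK/rev_ordK. Qed.

Lemma reflect_le (M : nat) (x y : Sigma M) :
  (x <= y)%O -> (reflect_seq y <= reflect_seq x)%O.
Proof.
move=> xy; apply: lexi_leP => n eqyx.
have := leq_first_diff xy (n := n).
have eqxy i : i < n -> x i = y i.
  by move=> /eqyx/rev_ord_inj.
by move=> /(_ eqxy); rewrite /reflect_seq /=; lia.
Qed.

Definition dominates {M : nat} (a x : Sigma M) : Prop :=
  forall n, (iter n (@shift_seq M) x <= a)%O.

Lemma reflect_geP (M : nat) (a x : Sigma M) :
  (reflect_seq a <= x)%O = (reflect_seq x <= a)%O.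
Proof.
by apply/idP/idP => /reflect_le; rewrite reflect_seqK.
Qed.

Lemma dominates_pairP (M : nat) (a x : Sigma M) :
  (forall n, (reflect_seq a <= iter n (@shift_seq M) x <= a)%O) <->
  dominates a x /\ dominates a (reflect_seq x).
Proof.
split=> [V|[ax arx] n]; last first.
  by rewrite ax andbT reflect_geP -iter_shift_reflect arx.
split=> n; first by have /andP[] := V n.
by have /andP[+ _] := V n; rewrite reflect_geP iter_shift_reflect.
Qed.

(** * The counter automaton *)

Definition step {M : nat} (a : Sigma M) (k : nat) (c : 'I_M.+1) : nat :=
  if c == a k then k.+1 else 0.

Definition run {M : nat} (a : Sigma M) (k : nat) (w : seq 'I_M.+1) : nat :=
  foldl (step a) k w.

Fixpoint legal {M : nat} (a : Sigma M) (k : nat) (w : seq 'I_M.+1) : bool :=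
  if w is c :: w' then (c <= a k) && legal a (step a k c) w' else true.

Lemma run_cat (M : nat) (a : Sigma M) k u v :
  run a k (u ++ v) = run a (run a k u) v.
Proof. exact: foldl_cat. Qed.

Lemma run_cons (M : nat) (a : Sigma M) k c u :
  run a k (c :: u) = run a (step a k c) u.
Proof. by []. Qed.

Lemma legal_cons (M : nat) (a : Sigma M) k (c : 'I_M.+1) u :
  legal a k (c :: u) = (c <= a k) && legal a (step a k c) u.
Proof. by []. Qed.

Lemma run_rcons (M : nat) (a : Sigma M) k u c :
  run a k (rcons u c) = step a (run a k u) c.
Proof. by rewrite /run foldl_rcons. Qed.

Lemma legal_cat (M : nat) (a : Sigma M) k u v :
  legal a k (u ++ v) = legal a k u && legal a (run a k u) v.
Proof. by elim: u k => //= c u IH k; rewrite IH andbA. Qed.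

Lemma legal_rcons (M : nat) (a : Sigma M) k u c :
  legal a k (rcons u c) = legal a k u && (c <= a (run a k u)).
Proof. by rewrite -cats1 legal_cat /= andbT. Qed.

Lemma run_suffix (M : nat) (a : Sigma M) (w : seq 'I_M.+1) :
  exists u, w = u ++ mkseq a (run a 0 w).
Proof.
elim/last_ind: w => [|w c [u IH]]; first by exists [::].
rewrite run_rcons /step; case: eqP => [cE|_]; last first.
  by exists (rcons w c); rewrite cats0.
by exists u; rewrite mkseqS -rcons_cat -IH cE.
Qed.

Lemma run_mkseq (M : nat) (a : Sigma M) n : run a 0 (mkseq a n) = n.
Proof. by elim: n => // n IH; rewrite mkseqS run_rcons /step IH eqxx. Qed.

(** The values [j < k] are the shorter matches to which a string-matching automaton would fall back;
    [step] falls to 0 instead. *)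
Definition border {M : nat} (a : Sigma M) (j k : nat) : Prop :=
  j <= k /\ forall i, i < j -> a (k - j + i) = a i.

Lemma border0 (M : nat) (a : Sigma M) k : border a 0 k.
Proof. by []. Qed.

Lemma border_leq (M : nat) (a : Sigma M) j k :
  dominates a a -> border a j k -> (a k <= a j).
Proof.
move=> aa [jk eqa]; have := leq_first_diff (aa (k - j)) (n := j).
rewrite iter_shiftE subnK //; apply=> i ij.
by rewrite iter_shiftE eqa.
Qed.

(** Since [c <= a k <= a j], a match at [j] forces one at [k]: no shorter match survives a legal
    reset, which justifies falling to 0. *)
Lemma border_step (M : nat) (a : Sigma M) j k (c : 'I_M.+1) :
  dominates a a -> border a j k -> (c <= a k) ->
  border a (step a j c) (step a k c).
Proof.
move=> aa bjk ck; have ajk := border_leq aa bjk; case: (bjk) => jk eqa.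
rewrite /step; case: (eqVneq c (a j)) => [cj|_]; last exact: border0.
have -> : c == a k by rewrite -val_eqE /= eqn_leq ck cj ajk.
split=> // i; rewrite ltnS leq_eqVlt subSS => /predU1P[->|]; last exact: eqa.
by rewrite subnK // -cj; apply/val_inj/eqP; rewrite /= eqn_leq ck cj ajk.
Qed.

Lemma border_run (M : nat) (a : Sigma M) j k w :
  dominates a a -> border a j k -> legal a k w ->
  legal a j w /\ border a (run a j w) (run a k w).
Proof.
move=> aa; elim: w j k => //= c w IH j k bjk /andP[ck lw].
have [] := IH _ _ (border_step aa bjk ck) lw.
by rewrite (leq_trans ck (border_leq aa bjk)).
Qed.

(* Reading on from a larger state can only be more restrictive; once that
   state is reset, the two runs coincide. *)
Lemma run_reset (M : nat) (a : Sigma M) k w :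
  dominates a a -> legal a k w -> run a k w = 0 -> run a 0 w = 0.
Proof.
move=> aa lw rw; have [_ []] := border_run aa (border0 a k) lw.
by rewrite rw leqn0 => /eqP.
Qed.

Lemma mkseqD (T : Type) (x : nat -> T) m n :
  mkseq x (m + n) = mkseq x m ++ mkseq (fun i => x (m + i)) n.
Proof.
elim: n => [|n IH]; first by rewrite addn0 cats0.
by rewrite addnS !mkseqS IH rcons_cat.
Qed.

Lemma eq_mkseq_in (T : Type) (x y : nat -> T) n :
  (forall i, i < n -> x i = y i) -> mkseq x n = mkseq y n.
Proof.
elim: n => // n IH eqxy; rewrite !mkseqS eqxy // IH // => i ilt.
exact/eqxy/ltnW.
Qed.

Lemma reflect_word_mkseq (M : nat) (x : Sigma M) n :
  reflect_word (mkseq x n) = mkseq (reflect_seq x) n.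
Proof. by rewrite /reflect_word /mkseq -map_comp. Qed.

Lemma run_mkseq_suffix (M : nat) (a x : Sigma M) n (k := run a 0 (mkseq x n)) :
  k <= n /\ forall i, i < k -> x (n - k + i) = a i.
Proof.
have [u uE] := run_suffix a (mkseq x n); rewrite -/k in uE.
have sz : n = (size u + k).
  by rewrite -[LHS](size_mkseq x) uE size_cat size_mkseq.
split=> [|i ik]; first by rewrite sz leq_addl.
have -> : (n - k + i = size u + i) by rewrite [in LHS]sz addnK.
rewrite -(nth_mkseq ord0 x (n := n)); last by rewrite sz ltn_add2l.
by rewrite uE nth_cat ltnNge leq_addr /= addKn nth_mkseq.
Qed.

(** The counter marks the shift of [x] whose comparison with [a] bounds the next symbol. Conversely,
    if a shift first differs from [a] at offset [m], restarting the counter where this shift begins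
    keeps the run legal and brings it to state [m]. *)
Lemma dominatesP (M : nat) (a x : Sigma M) : dominates a a ->
  dominates a x <-> forall n, legal a 0 (mkseq x n).
Proof.
move=> aa; split=> [ax|lx n].
  elim=> // n IH; rewrite mkseqS legal_rcons IH /=.
  have [kn eqa] := run_mkseq_suffix a x n.
  set k := run _ _ _ in kn eqa *.
  have := leq_first_diff (ax (n - k)) (n := k).
  rewrite iter_shiftE subnK //; apply=> i ik.
  by rewrite iter_shiftE eqa.
apply: lexi_leP => m eqa.
have := lx (n + m.+1).
have -> : mkseq x (n + m.+1) = mkseq x n ++ rcons (mkseq a m) (x (n + m)).
  rewrite mkseqD mkseqS; congr (_ ++ rcons _ _).
  by apply: eq_mkseq_in => i im; rewrite -eqa // iter_shiftE.
rewrite legal_cat => /andP[_ lw].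
have [+ _] := border_run aa (border0 a _) lw.
by rewrite legal_rcons run_mkseq iter_shiftE => /andP[].
Qed.

(* The second conjunct is the lower bound: [x] lies above the reflection of [a]
   iff its reflection lies below [a]. *)
Definition admissible {M : nat} (a x : Sigma M) : Prop :=
  dominates a x /\ dominates a (reflect_seq x).

Definition legal2 {M : nat} (a : Sigma M) (w : seq 'I_M.+1) : bool :=
  legal a 0 w && legal a 0 (reflect_word w).

(** * Periodic sequences from lowered prefixes *)

(** Otherwise the two bounds squeeze every symbol of [a] to the first one, and [a] is its own
    reflection. *)
Lemma rev_ord_gap (M : nat) (a : Sigma M) :
  dominates a a -> dominates a (reflect_seq a) -> a <> reflect_seq a ->
  (rev_ord (a 0) < a 0).
Proof.
move=> aa ar; rewrite ltnNge => neq; apply/negP => a0; apply: neq.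
have a0r : (rev_ord (a 0) <= a 0) by exact: (leq_first_diff (ar 0)).
apply/funext => n; apply/val_inj; rewrite /reflect_seq /=.
have an : iter n (@shift_seq M) a 0 <= a 0 by exact: (leq_first_diff (aa n)).
have rn : iter n (@shift_seq M) (reflect_seq a) 0 <= a 0.
  exact: (leq_first_diff (ar n)).
rewrite !iter_shiftE addn0 in an rn.
move: a0 a0r an rn; rewrite /reflect_seq /=.
have := ltn_ord (a 0); have := ltn_ord (a n); lia.
Qed.

Lemma periodic_modn (T : Type) (p : nat -> T) N :
  (forall i, p (N + i) = p i) -> forall i, p (i %% N) = p i.
Proof.
move=> pN i; rewrite [in RHS](divn_eq i N).
by elim: (i %/ N) => // d IH; rewrite mulSn -addnA pN.
Qed.

Lemma dominates_periodic (M : nat) (a p : Sigma M) N : 0 < N ->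
  (forall i, p (N + i) = p i) ->
  (forall s, s < N -> (iter s (@shift_seq M) p <= a)%O) -> dominates a p.
Proof.
move=> N0 pN ps n.
have -> : iter n (@shift_seq M) p = iter (n %% N) (@shift_seq M) p.
  apply/funext => i; rewrite !iter_shiftE.
  by rewrite -(periodic_modn pN) -[RHS](periodic_modn pN) modnDml.
exact/ps/ltn_pmod.
Qed.

Section PeriodicWord.
Variables (M : nat) (a p : Sigma M) (k : nat).
Hypotheses (aa : dominates a a) (ar : dominates a (reflect_seq a)).
Hypothesis no_suffix : run a 0 (reflect_word (mkseq a k.+1)) = 0.
(* Excludes the one-symbol word when [a 0] and its reflection differ by 1. *)
Hypothesis long : (0 < k) \/ ((rev_ord (a 0)).+1 < a 0).
Hypothesis gap : (rev_ord (a 0) < a 0).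
Hypothesis p_periodic : forall i, p (k.+1 + i) = p i.
Hypothesis p_prefix : forall i, i < k -> p i = a i.
Hypothesis p_last : (p k).+1 = a k.

(** Two pieces of [a] are compared until the lowered symbol, which is smaller than the symbol of [p]
    it meets; so the comparison never passes the end of the period. *)
Lemma periodic_dominates : dominates p p.
Proof using aa p_periodic p_prefix p_last.
clear ar no_suffix long gap.
apply: (dominates_periodic (ltn0Sn k) p_periodic) => -[|s] sk //.
apply: lexi_leP => m eqp0; rewrite iter_shiftE.
have eqp i : i < m -> p (s.+1 + i) = p i by move=> /eqp0; rewrite iter_shiftE.
have first_a n : n <= m -> (s.+1 + n <= k) -> (a (s.+1 + n) <= a n).
  move=> nm nk; have := leq_first_diff (aa s.+1) (n := n); rewrite iter_shiftE.
  apply=> i im; rewrite iter_shiftE -p_prefix; last by lia.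
  by rewrite eqp ?p_prefix //; lia.
have [lt_k|gt_k|eq_k] := ltngtP (s.+1 + m) k.
- by rewrite !p_prefix ?first_a //; lia.
- have := first_a (k - s.+1); rewrite subnKC // -p_last.
  have := eqp (k - s.+1); rewrite subnKC //.
  rewrite [p (k - _)]p_prefix; last by lia.
  move=> -> //; lia.
- by have := first_a m; rewrite eq_k -p_last (@p_prefix m); lia.
Qed.

(** The first symbols settle shift 0. For other shifts the bound for [a] is used up to the lowered
    symbol; there the reflection grows by 1, so a strict bound is required, and [no_suffix] supplies
    it. *)
Lemma reflect_periodic_dominates : dominates p (reflect_seq p).
Proof.
have rp_periodic i : reflect_seq p (k.+1 + i) = reflect_seq p i.
  by rewrite /reflect_seq p_periodic.
apply: (dominates_periodic (ltn0Sn k) rp_periodic) => -[|s] sk.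
  apply: lexi_leP => -[_|m /(_ 0 (ltn0Sn _))].
    rewrite /reflect_seq /=; case: (posnP k) => [k0|k0].
      move: long p_last; rewrite k0 => -[//|/= gap2 p0]; lia.
    by rewrite /= p_prefix // ltnW.
  rewrite /reflect_seq [iter _ _ _]/=; case: (posnP k) => [k0|k0]; last first.
    by rewrite p_prefix // => E; move: gap; rewrite E ltnn.
  by move=> E; rewrite -(periodic_modn p_periodic) k0 modn1 E.
apply: lexi_leP => m.
(* Agreement may continue past the end of the period, hence an induction on a bound for [m], for all
   shifts at once. *)
have [n mn] : exists n, (m < n) by exists m.+1.
elim: n s m mn sk => // n IH s m mn sk.
rewrite iter_shiftE => eqp0.
have eqp i : i < m -> reflect_seq p (s.+1 + i) = p i.
  by move=> /eqp0; rewrite iter_shiftE.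
have first_a i : i <= m -> (s.+1 + i <= k) ->
    (forall j, j < i -> rev_ord (a (s.+1 + j)) = a j) /\
    (rev_ord (a (s.+1 + i)) <= a i).
  move=> im ik.
  have eqa j : j < i -> rev_ord (a (s.+1 + j)) = a j.
    move=> ji; rewrite -!p_prefix; [|lia..].
    by apply: eqp; lia.
  split=> //; have := leq_first_diff (ar s.+1) (n := i); rewrite iter_shiftE.
  by apply=> j ji; rewrite iter_shiftE; apply: eqa.
have strict i : i <= m -> (s.+1 + i) = k -> (rev_ord (a k) < a i).
  move=> im ik; have [|eqa] := first_a i im; first by rewrite ik.
  rewrite ik leq_eqVlt => /predU1P[/val_inj eqk|//].
  (* equality would make a suffix of the reflected prefix a prefix of [a] *)
  have wE : reflect_word (mkseq a k.+1) =
      reflect_word (mkseq a s.+1) ++ mkseq a i.+1.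
    rewrite !reflect_word_mkseq -ik -addnS mkseqD; congr (_ ++ _).
    apply: eq_mkseq_in => j; rewrite ltnS leq_eqVlt /reflect_seq.
    by move=> /predU1P[->|/eqa //]; rewrite ik eqk.
  have lw : legal a 0 (reflect_word (mkseq a k.+1)).
    by rewrite reflect_word_mkseq; apply: (dominatesP _ aa).1.
  move: lw no_suffix; rewrite wE legal_cat run_cat => /andP[_ lw].
  by move=> /(run_reset aa lw); rewrite run_mkseq.
have [lt_k|gt_k|eq_k] := ltngtP (s.+1 + m) k.
- have [_ le_a] := first_a m (leqnn m) (ltnW lt_k).
  by rewrite /reflect_seq !p_prefix //; lia.
- (* past the end of the period, the comparison is the reflection of the one
     for the complementary shift, with fewer symbols left *)
  pose s' := (k - s.+1); have [m' mE] : exists m', m = (s'.+1 + m').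
    by exists (m - s'.+1); rewrite /s'; lia.
  have E j : p (s.+1 + (s'.+1 + j)) = p j.
    by rewrite -(p_periodic j); congr p; rewrite /s'; lia.
  have : (rev_ord (p m) <= p m').
    rewrite mE; have := IH s' m'; rewrite iter_shiftE; apply; try by lia.
    move=> j jm; rewrite iter_shiftE /reflect_seq.
    have := eqp (s'.+1 + j); rewrite /reflect_seq E => <-; last by lia.
    by rewrite rev_ordK.
  have -> : reflect_seq p (s.+1 + m) = rev_ord (p m').
    by rewrite /reflect_seq mE E.
  by rewrite /=; have := ltn_ord (p m); have := ltn_ord (p m'); lia.
- have := strict m (leqnn m) eq_k; rewrite eq_k /reflect_seq /= -p_last.
  rewrite (@p_prefix m); last by lia.
  have := ltn_ord (a k); rewrite -p_last; lia.
Qed.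

End PeriodicWord.

Lemma word_minus_rcons (M : nat) (s : seq 'I_M.+1) c :
  word_minus (rcons s c) = rcons s (inord c.-1).
Proof. by case: s => //= d s; rewrite belast_rcons last_rcons. Qed.

Lemma word_plus_rcons (M : nat) (s : seq 'I_M.+1) c :
  word_plus (rcons s c) = rcons s (inord c.+1).
Proof. by case: s => //= d s; rewrite belast_rcons last_rcons. Qed.

Lemma word_periodic_reflect (M : nat) (w : seq 'I_M.+1) : (0 < size w) ->
  word_periodic (reflect_word w) = reflect_seq (word_periodic w).
Proof.
move=> w0; apply/funext => i; rewrite /word_periodic /reflect_seq size_map.
by rewrite (nth_map ord0) // ltn_pmod.
Qed.

Lemma word_plus_reflect (M : nat) (s : seq 'I_M.+1) (c : 'I_M.+1) :
  0 < c ->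
  word_plus (reflect_word (rcons s c)) = reflect_word (word_minus (rcons s c)).
Proof.
move=> c0; rewrite word_minus_rcons /reflect_word !map_rcons word_plus_rcons.
have cM := ltn_ord c.
by congr rcons; apply/val_inj; rewrite /= !inordK; lia.
Qed.

(** * Irreducible sequences *)

Section Irreducible.
Variables (M : nat) (a : Sigma M).
Hypothesis irr : irreducible_seq a.
Hypothesis ne : forall n, iter n (@shift_seq M) a <> reflect_seq a.

Let adm : admissible a a.
Proof. by apply/dominates_pairP => n; case: irr => V _; exact: V. Qed.

Let aa : dominates a a := adm.1.

Lemma top_gap : (rev_ord (a 0) < a 0).
Proof. exact: rev_ord_gap aa adm.2 (@ne 0). Qed.

Lemma admissible_legal x n :
  admissible a x -> legal a 0 (mkseq x n) /\ legal a 0 (mkseq (reflect_seq x) n).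
Proof. by move=> [ax arx]; split; apply: (dominatesP _ aa).1. Qed.

(** Irreducibility enters here: the prefix followed by the reflection of [p] is below [a], and as
    both agree on the prefix, the strict drop occurs at some offset [m] after it. *)
Lemma lowered_prefix (k : nat) :
  run a 0 (reflect_word (mkseq a k.+1)) = 0 ->
  (0 < k) \/ ((rev_ord (a 0)).+1 < a 0) ->
  exists p : Sigma M,
    [/\ admissible a p,
        dominates p (reflect_seq p),
        [/\ forall i, p (k.+1 + i) = p i,
            forall i, i < k -> p i = a i & (p k).+1 = a k] &
        exists2 m, forall i, i < m -> reflect_seq p i = a (k.+1 + i) &
          (reflect_seq p m < a (k.+1 + m))].
Proof.
move=> no_suffix long.
(* The reflection of 0 is the largest symbol, legal only if it is the predicted one; the run could
   then not end in 0. *)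
have ak0 : (0 < a k).
  have := (admissible_legal k.+1 adm).2.
  rewrite -reflect_word_mkseq; move: no_suffix.
  rewrite mkseqS /reflect_word map_rcons run_rcons legal_rcons /step.
  case: eqVneq => // neq _ /andP[_ le_a]; rewrite lt0n; apply/eqP => ak.
  case/eqP: neq; apply/val_inj/eqP; rewrite eqn_leq le_a /= ak subn1 /=.
  by rewrite -ltnS ltn_ord.
pose w := word_minus (prefix_of a k.+1); pose p := word_periodic w.
have wE : w = rcons (mkseq a k) (inord (a k).-1).
  by rewrite /w /prefix_of mkseqS word_minus_rcons.
have sw : size w = k.+1 by rewrite wE size_rcons size_mkseq.
have p_periodic i : p (k.+1 + i) = p i by rewrite /p /word_periodic sw modnDl.
have p_nth i : (i < k.+1) -> p i = nth ord0 w i.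
  by move=> ik; rewrite /p /word_periodic sw modn_small.
have p_prefix i : i < k -> p i = a i.
  move=> ik; rewrite (p_nth _ (ltnW ik)) wE nth_rcons size_mkseq ik.
  by rewrite nth_mkseq.
have p_last : (p k).+1 = a k.
  rewrite p_nth // wE nth_rcons size_mkseq ltnn eqxx inordK ?prednK //.
  exact/ltnW/ltn_ord.
have pp := periodic_dominates aa p_periodic p_prefix p_last.
have rpp := reflect_periodic_dominates aa adm.2 no_suffix long top_gap
  p_periodic p_prefix p_last.
have p_le_a : (p <= a)%O.
  apply: lexi_leP => n eqp; case: (ltngtP n k) => [nk|kn|->].
  - by rewrite p_prefix.
  - by move: p_last; rewrite eqp // => /esym/n_Sn.
  - by rewrite -p_last.
have irrk := irr.2 k.+1 isT ak0 ((dominates_pairP _ _).2 (conj pp rpp)).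
have sw0 : (0 < size w) by rewrite sw.
rewrite /prefix_of mkseqS word_plus_reflect // -mkseqS in irrk.
rewrite -/(prefix_of a k.+1) -/w (word_periodic_reflect sw0) -/p in irrk.
exists p; split=> //.
  by split=> n; apply: le_trans p_le_a.
have [n eqn ltn] := lexi_ltP irrk.
have kn : (k.+1 <= n).
  rewrite leqNgt; apply/negP => nk; move: ltn.
  by rewrite /word_cat size_mkseq nk nth_mkseq // ltnn.
have catE i : word_cat (prefix_of a k.+1) (reflect_seq p) (k.+1 + i) =
    reflect_seq p i.
  by rewrite /word_cat size_mkseq ltnNge leq_addr /= addKn.
exists (n - k.+1) => [i im|].
  by rewrite -catE eqn //; lia.
by rewrite -catE subnKC.
Qed.

(** * Descent of the lower counter *)

Lemma reflect_word_cat (u v : seq 'I_M.+1) :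
  reflect_word (u ++ v) = reflect_word u ++ reflect_word v.
Proof. exact: map_cat. Qed.

(** Along [p] the upper counter returns to 0 at the end of each period, while the lower one follows
    [a] from [k.+1] until the strict drop resets it. Afterwards it stays at most [k], since [p]
    dominates its reflection. *)
Lemma descend (k : nat) (u : seq 'I_M.+1) :
  legal2 a u -> run a 0 u = 0 -> run a 0 (reflect_word u) = k.+1 ->
  (0 < k) \/ ((rev_ord (a 0)).+1 < a 0) ->
  exists w, [/\ legal2 a (u ++ w), run a 0 (u ++ w) = 0 &
    (run a 0 (reflect_word (u ++ w)) <= k)].
Proof.
move=> /andP[lu lru] ru rru long.
(* The word [u] ends in the reflected prefix, and a counter that is 0 after [u] is also 0 after this
   suffix read alone. *)
have no_suffix : run a 0 (reflect_word (mkseq a k.+1)) = 0.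
  have [v vE] := run_suffix a (reflect_word u).
  have uE : u = reflect_word v ++ reflect_word (mkseq a k.+1).
    by rewrite -reflect_word_cat -rru -vE reflect_wordK.
  move: lu ru; rewrite uE legal_cat run_cat => /andP[_ lu].
  exact: run_reset.
have [p [admp rpp [p_periodic p_prefix p_last] [m eqm ltm]]] :=
  lowered_prefix no_suffix long.
have run_eq i : i <= m -> run a k.+1 (mkseq (reflect_seq p) i) = (k.+1 + i)
    /\ legal a k.+1 (mkseq (reflect_seq p) i).
  elim: i => [|i IH] im; first by rewrite addn0.
  have [ri li] := IH (ltnW im).
  by rewrite mkseqS run_rcons legal_rcons ri li /step eqm // eqxx addnS leqnn.
have [rm lm] := run_eq m (leqnn m).
have lm1 : legal a k.+1 (mkseq (reflect_seq p) m.+1).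
  by rewrite mkseqS legal_rcons rm lm ltnW.
have rm1 : run a k.+1 (mkseq (reflect_seq p) m.+1) = 0.
  rewrite mkseqS run_rcons rm /step; case: eqVneq => // E.
  by move: ltm; rewrite E ltnn.
have rm0 := run_reset aa lm1 rm1.
(* A multiple of the period brings the upper counter to 0, and [m.+1] symbols suffice to reset the
   lower one. *)
have [n [d n_mul nE]] : exists n, exists2 d, n = (m.+1 * k.+1) & n = (m.+1 + d).
  exists (m.+1 * k.+1), (m.+1 * k.+1 - m.+1) => //.
  by rewrite subnKC // leq_pmulr.
have [lp lrp] := admissible_legal n admp.
exists (mkseq p n); rewrite /legal2 reflect_word_cat reflect_word_mkseq.
rewrite !legal_cat !run_cat lu lru ru rru lp /=.
have -> : legal a k.+1 (mkseq (reflect_seq p) n).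
  rewrite nE mkseqD legal_cat lm1 rm1.
  by move: lrp; rewrite nE mkseqD legal_cat rm0 => /andP[].
have -> : run a k.+1 (mkseq (reflect_seq p) n) = run a 0 (mkseq (reflect_seq p) n).
  by rewrite nE mkseqD !run_cat rm1 rm0.
split=> //.
  rewrite n_mul; elim: m.+1 => // j IH.
  rewrite mulSn mkseqD run_cat.
  have -> : run a 0 (mkseq p k.+1) = 0.
    rewrite mkseqS run_rcons (eq_mkseq_in p_prefix) run_mkseq /step.
    by case: eqVneq p_last => // ->; lia.
  by rewrite (eq_mkseq_in (y := p)).
(* a counter above [k] would exhibit a shift of [reflect_seq p] that begins
   with the unlowered prefix of [a], hence exceeds [p] *)
set r := run _ _ _; rewrite leqNgt; apply/negP => kr.
have [_ eqa] := run_mkseq_suffix a (reflect_seq p) n; rewrite -/r in eqa.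
suff : (a k <= p k) by rewrite -p_last ltnn.
rewrite -(eqa k kr) -iter_shiftE; apply: (leq_first_diff (rpp (n - r))) => i ik.
by rewrite iter_shiftE eqa ?p_prefix // (ltn_trans ik).
Qed.

(** A counter that is never reset grows by 1 at each symbol, so all further symbols are those
    predicted by [a]. *)
Lemma never_reset (x : Sigma M) n :
  (forall j, run a 0 (mkseq x (n + j)) <> 0) ->
  exists r, forall i, x (r + i) = a i.
Proof.
move=> nz; set k := run a 0 (mkseq x n).
have runE j : run a 0 (mkseq x (n + j)) = (k + j).
  elim: j => [|j IH]; first by rewrite !addn0.
  have := nz j.+1; rewrite !addnS mkseqS run_rcons IH /step.
  by case: eqP.
have [kn _] := run_mkseq_suffix a x n.
exists (n - k) => i.
have [_ eqa] := run_mkseq_suffix a x (n + i.+1); rewrite runE subnDr in eqa.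
by apply: eqa; rewrite addnS ltnS leq_addl.
Qed.

(** Otherwise [y] and its reflection both have [a] as a tail; comparing where the tails start makes
    a shift of [a] equal to its reflection, against [ne]. *)
Lemma eventually_reset (y : Sigma M) n : exists2 m, (n <= m) &
  run a 0 (mkseq y m) = 0 \/ run a 0 (mkseq (reflect_seq y) m) = 0.
Proof.
apply: contrapT => noreset.
have [|r yr] := @never_reset y n.
  by move=> j rj; apply: noreset; exists (n + j); [exact: leq_addr|left].
have [|s ys] := @never_reset (reflect_seq y) n.
  by move=> j rj; apply: noreset; exists (n + j); [exact: leq_addr|right].
have [rs|/ltnW sr] := leqP r s.
  apply: (ne (n := s - r)); apply/funext => i.
  rewrite iter_shiftE /reflect_seq -(ys i) /reflect_seq rev_ordK -yr.
  by rewrite addnA subnKC.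
apply: (ne (n := r - s)); apply/funext => i.
by rewrite iter_shiftE /reflect_seq -(yr i) -ys /reflect_seq addnA subnKC.
Qed.

Lemma legal2_reflect w : legal2 a (reflect_word w) = legal2 a w.
Proof. by rewrite /legal2 reflect_wordK andbC. Qed.

(** Says that some symbol lies strictly between the extreme ones. Read as a number, [~~ wide] is the
    value to which the descent brings the lower counter. *)
Definition wide : bool := ((rev_ord (a 0)).+1 < a 0).

Lemma descend_all (u : seq 'I_M.+1) :
  legal2 a u -> run a 0 u = 0 ->
  exists w, [/\ legal2 a (u ++ w), run a 0 (u ++ w) = 0 &
    (run a 0 (reflect_word (u ++ w)) <= ~~ wide)].
Proof.
have [n] := ubnP (run a 0 (reflect_word u)).
elim: n u => // n IH u; rewrite ltnS => un lu ru.
have [le_w|] := leqP (run a 0 (reflect_word u)) (~~ wide).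
  by exists [::]; rewrite cats0.
case rru : (run a 0 (reflect_word u)) => [//|k] wk.
have [|w [lw rw rrw]] := descend lu ru rru.
  by case: (boolP wide) wk => [gap _|_ wk]; [right|left].
have [|v [lv rv rrv]] := IH (u ++ w) _ lw rw; first by rewrite rru in un; lia.
by exists (w ++ v); rewrite catA.
Qed.

(** * Admissible continuations and loops *)

Lemma word_cat_admissible (w : seq 'I_M.+1) (x : Sigma M) :
  legal2 a w -> (forall n, legal a (run a 0 w) (mkseq x n)) ->
  (forall n, legal a (run a 0 (reflect_word w)) (mkseq (reflect_seq x) n)) ->
  admissible a (word_cat w x).
Proof.
have dom v y : legal a 0 v -> (forall n, legal a (run a 0 v) (mkseq y n)) ->
    dominates a (word_cat v y).
  move=> lv ly; apply/(dominatesP _ aa) => n.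
  suff : legal a 0 (mkseq (word_cat v y) (n + size v)).
    by rewrite mkseqD legal_cat => /andP[].
  rewrite addnC mkseqD legal_cat.
  have -> : mkseq (word_cat v y) (size v) = v.
    rewrite -[RHS](mkseq_nth ord0); apply: eq_mkseq_in => i iv.
    by rewrite /word_cat iv.
  rewrite lv (eq_mkseq_in (y := y)) ?ly // => i _.
  by rewrite /word_cat ltnNge leq_addr /= addKn.
move=> /andP[lw lrw] lx lrx; split; first exact: dom.
have -> : reflect_seq (word_cat w x) = word_cat (reflect_word w) (reflect_seq x).
  apply/funext => i; rewrite /reflect_seq /word_cat size_map.
  by case: ifP => // iw; rewrite (nth_map ord0).
exact: dom.
Qed.

(* The state at which the loop sits has upper counter 0 and lower counter [k]. *)
Definition loop (k : nat) (w : seq 'I_M.+1) : bool :=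
  [&& legal a 0 w, run a 0 w == 0, legal a k (reflect_word w) &
      run a k (reflect_word w) == k].

Lemma loop_cat k u v : loop k u -> loop k v -> loop k (u ++ v).
Proof.
move=> /and4P[lu /eqP ru lru /eqP rru] /and4P[lv rv lrv rrv].
by rewrite /loop reflect_word_cat !legal_cat !run_cat ru rru lu lru lv rv lrv rrv.
Qed.

Definition loop_length (k n : nat) : Prop := exists2 w, size w = n & loop k w.

Lemma loop_lengthD k m n :
  loop_length k m -> loop_length k n -> loop_length k (m + n).
Proof.
move=> [u su lu] [v sv lv]; exists (u ++ v); last exact: loop_cat.
by rewrite size_cat su sv.
Qed.

Lemma loop_lengthM k m n : loop_length k m -> loop_length k (n * m).
Proof.
move=> lm; elim: n => [|n IH]; last by rewrite mulSn; apply: loop_lengthD.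
by exists [::]; rewrite // /loop /= !eqxx.
Qed.

Lemma admissible_first (x : Sigma M) : admissible a x ->
  (x 0 <= a 0) /\ (rev_ord (a 0) <= x 0).
Proof.
move=> [/(_ 0) ax /(_ 0) arx]; split; first exact: (leq_first_diff ax).
have : reflect_seq x 0 <= a 0 by exact: (leq_first_diff arx).
rewrite /reflect_seq /=.
by have := ltn_ord (a 0); have := ltn_ord (x 0); lia.
Qed.

(** * The case of adjacent extreme symbols *)

Section Narrow.
Hypothesis narrow : ~~ wide.

Let top := a 0.
Let bot := rev_ord (a 0).

Lemma bot_top : bot.+1 = top.
Proof.
by apply/eqP; move: narrow; rewrite /wide eqn_leq top_gap -leqNgt.
Qed.

(** Where the reflection of [a] first drops below the shift of [a], the symbol of [a] and its
    successor are both [top]; as no shift of [a] exceeds [a], the second symbol of [a] is [top]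
    too. *)
Lemma a1_top : a 1 = top.
Proof.
have [n eqn lt_n] : exists2 n, forall i, i < n -> rev_ord (a i) = a (1 + i) &
    (rev_ord (a n) < a (1 + n)).
  have : (reflect_seq a < iter 1 (@shift_seq M) a)%O.
    rewrite lt_neqAle reflect_geP -iter_shift_reflect adm.2 andbT.
    by apply/eqP => /esym; apply: ne.
  by move=> /lexi_ltP[n eqn lt_n]; exists n.
have a_le i : (a i <= top).
  by have := leq_first_diff (aa i) (n := 0); rewrite iter_shiftE addn0; apply.
have an : a n = a 0.
  apply/val_inj/eqP; rewrite eqn_leq a_le /=.
  move: (leq_trans lt_n (a_le _)) bot_top; rewrite /bot /top /=.
  by have := ltn_ord (a 0); have := ltn_ord (a n); lia.
have le1 : a n.+1 <= a 1.
  rewrite -[n.+1]addn1 -iter_shiftE; apply: (leq_first_diff (aa n)) => -[|//] _.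
  by rewrite iter_shiftE addn0.
apply/val_inj/eqP; rewrite eqn_leq a_le /= -bot_top.
by apply: leq_trans le1; rewrite /bot -an.
Qed.

Lemma narrow_digit (x : Sigma M) : admissible a x -> x 0 = top \/ x 0 = bot.
Proof.
move=> /admissible_first[xt bx]; case: (eqVneq (x 0) top) => [|neq]; first by left.
right; apply/val_inj/eqP; rewrite eqn_leq bx andbT -ltnS bot_top ltn_neqAle xt.
by rewrite andbT; apply: contra neq => /eqP/val_inj->.
Qed.

Lemma step_top0 : step a 0 top = 1.
Proof. by rewrite /step eqxx. Qed.

Lemma step_bot k : k <= 1 -> step a k bot = 0.
Proof.
have nbt : (bot == top) = false.
  by apply/eqP => E; move: bot_top; rewrite E => /esym/n_Sn.
by case: k => [|[|//]] _; rewrite /step ?a1_top nbt.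
Qed.

Lemma bot_legal k : k <= 1 -> (bot <= a k).
Proof.
by case: k => [|[|//]] _; rewrite ?a1_top -?[a 0]/top -bot_top leqnSn.
Qed.

Lemma top_legal k : k <= 1 -> (top <= a k).
Proof. by case: k => [|[|//]] _; rewrite ?a1_top. Qed.

Lemma loop_even : loop_length 1 2.
Proof.
exists [:: top; bot] => //.
rewrite /loop /reflect_word !map_cons rev_ordK -/bot !legal_cons !run_cons.
by rewrite !step_top0 !(step_bot, bot_legal, top_legal) // step_top0 !eqxx.
Qed.

(** Here [p] alternates [top] and [bot]. The loop reads [top], [top], then the reflection of [p]
    through its strict drop below [a], which resets the upper counter. *)
Lemma loop_odd : exists n, loop_length 1 n.*2.+1.
Proof.
have [||p [admp _ [p_periodic p_prefix p_last] [m eqm ltm]]] := @lowered_prefix 1.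
- by rewrite /reflect_word /mkseq /= a1_top -/bot !step_bot.
- by left.
have p0 : p 0 = top by rewrite p_prefix.
have p1 : p 1 = bot.
  by apply/val_inj/succn_inj; rewrite p_last a1_top bot_top.
have p_even j : p j.*2 = top.
  by elim: j => [|j IH]; rewrite ?p0 // -IH -[RHS]p_periodic.
have p_odd j : p j.*2.+1 = bot.
  by elim: j => [|j IH]; rewrite ?p1 // -IH -[RHS]p_periodic.
(* At odd offsets the reflection of [p] is [top], which cannot be strictly below a symbol of [a]. *)
have [j mE] : exists j, m = j.*2.
  exists m./2; rewrite -[LHS]odd_double_half; case: (boolP (odd m)) => // om.
  move: ltm; rewrite -[m]odd_double_half om add1n /reflect_seq p_odd rev_ordK ltnNge.
  have := leq_first_diff (aa (2 + m./2.*2.+1)) (n := 0).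
  by rewrite iter_shiftE addn0 => ->.
have run_p i : run a 0 (mkseq p i.*2) = 0.
  elim: i => // i IH; rewrite doubleS !mkseqS !run_rcons IH p_even p_odd.
  by rewrite step_top0 step_bot.
have run_rp i : i <= m -> run a 2 (mkseq (reflect_seq p) i) = (2 + i) /\
    legal a 2 (mkseq (reflect_seq p) i).
  elim: i => [|i IH] im //.
  have [ri li] := IH (ltnW im).
  by rewrite mkseqS run_rcons legal_rcons ri li /step eqm // eqxx addnS leqnn.
have [rm lm] := run_rp m (leqnn m).
have [v [sv lv rv lrv rrv]] : exists v, [/\ size v = m.+1, legal a 2 v,
    run a 2 v = 0, legal a 0 (reflect_word v) & run a 0 (reflect_word v) = 1].
  exists (mkseq (reflect_seq p) m.+1).
  have [lp _] := admissible_legal m.+1 admp.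
  rewrite size_mkseq reflect_word_mkseq reflect_seqK lp; split=> //.
  - by rewrite mkseqS legal_rcons rm lm ltnW.
  - rewrite mkseqS run_rcons rm /step; case: eqP => // E.
    by move: ltm; rewrite E ltnn.
  - by rewrite mkseqS run_rcons mE run_p p_even step_top0.
exists j.+1, [:: top, top & v]; first by rewrite /= sv mE doubleS.
rewrite /loop /reflect_word !map_cons -/(reflect_word v) -/bot !legal_cons !run_cons.
rewrite !step_bot // step_top0 lrv rrv !bot_legal // !top_legal //.
have -> : step a 1 top = 2 by rewrite /step a1_top eqxx.
by rewrite lv rv.
Qed.

(** From any other allowed state, the symbol [bot] resets the upper counter and raises the lower one
    from 0 to 1. *)
Lemma narrow_reach u :
  legal2 a u -> run a 0 u <= 1 -> run a 0 (reflect_word u) <= 1 ->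
  run a 0 u = 0 \/ run a 0 (reflect_word u) = 0 ->
  exists w, [/\ legal2 a (u ++ w), run a 0 (u ++ w) = 0 &
    run a 0 (reflect_word (u ++ w)) = 1].
Proof.
move=> lu ru; rewrite leq_eqVlt ltnS leqn0 => /orP[/eqP rru|/eqP rru _].
  by rewrite rru => -[ru0|//]; exists [::]; rewrite cats0.
move/andP: lu => [lu lru]; exists [:: bot].
have E : reflect_word [:: bot] = [:: top] by rewrite /reflect_word /= rev_ordK.
rewrite /legal2 reflect_word_cat !legal_cat !run_cat lu lru rru E.
by rewrite !legal_cons !run_cons step_top0 step_bot // bot_legal // top_legal.
Qed.

Lemma legal_bot_head (y : Sigma M) : y 0 = bot ->
  (forall n, legal a 0 (mkseq y n)) -> forall n, legal a 1 (mkseq y n).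
Proof.
move=> y0 ly [//|n]; have := ly n.+1.
rewrite -[n.+1]add1n mkseqD !legal_cat !legal_cons !run_cons y0 !step_bot //.
by rewrite !bot_legal.
Qed.

(** If [x] starts with [top], it can be read at once. If it starts with [bot], reading [top] first
    exchanges the two counters. *)
Lemma narrow_ready (x : Sigma M) : admissible a x ->
  exists v, [/\ legal a 0 v, legal a 1 (reflect_word v),
    forall n, legal a (run a 0 v) (mkseq x n) &
    forall n, legal a (run a 1 (reflect_word v)) (mkseq (reflect_seq x) n)].
Proof.
move=> admx; have lx n := (admissible_legal n admx).1.
have lrx n := (admissible_legal n admx).2.
case: (narrow_digit admx) => x0.
  exists [::]; split=> //; apply: legal_bot_head => //.
  by rewrite /reflect_seq x0.
exists [:: top]; rewrite /reflect_word map_cons -/bot !legal_cons !run_cons.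
rewrite step_top0 step_bot // bot_legal // top_legal //; split=> //.
exact: legal_bot_head.
Qed.

End Narrow.

(** * The hub state and mixing *)

Lemma hub : exists k N,
  [/\ forall u, legal2 a u -> run a 0 u <= ~~ wide ->
         run a 0 (reflect_word u) <= ~~ wide ->
         run a 0 u = 0 \/ run a 0 (reflect_word u) = 0 ->
         exists w, [/\ legal2 a (u ++ w), run a 0 (u ++ w) = 0 &
           run a 0 (reflect_word (u ++ w)) = k],
      forall n, N <= n -> loop_length k n &
      forall x, admissible a x ->
         exists v, [/\ legal a 0 v, legal a k (reflect_word v),
           forall n, legal a (run a 0 v) (mkseq x n) &
           forall n, legal a (run a k (reflect_word v)) (mkseq (reflect_seq x) n)]].
Proof.
case: (boolP wide) => [w|narrow]; last first.
  have [j lj] := loop_odd narrow.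
  exists 1, j.*2.+1; split; [exact: narrow_reach| |exact: narrow_ready].
  move=> n jn; have evenl i : loop_length 1 i.*2.
    by rewrite -muln2; apply/loop_lengthM/loop_even.
  rewrite -[n]odd_double_half; case: (boolP (odd n)) => on; last exact: evenl.
  (* An odd length is one odd loop followed by loops of length 2. *)
  have -> : true + n./2.*2 = j.*2.+1 + (n./2 - j).*2.
    by rewrite doubleB -[n in j.*2.+1 <= n]odd_double_half on in jn *; lia.
  exact: loop_lengthD.
exists 0, 0; split=> [u lu|n _|x admx].
- by rewrite !leqn0 => /eqP ru /eqP rru _; exists [::]; rewrite cats0.
- rewrite -[n]muln1; apply: loop_lengthM.
  (* This symbol and its reflection are both below [a 0], so reading it keeps both counters at 0. *)
  have wM : (rev_ord (a 0)).+1 < M.+1 by apply: ltn_trans w (ltn_ord _).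
  exists [:: Ordinal wM] => //.
  have neq1 : (Ordinal wM == a 0) = false.
    by rewrite -val_eqE; apply/ltn_eqF.
  have rlt : rev_ord (Ordinal wM) < a 0 by move: w; rewrite /wide /=; lia.
  have neq2 : (rev_ord (Ordinal wM) == a 0) = false.
    by rewrite -val_eqE; apply/ltn_eqF.
  rewrite /loop /reflect_word map_cons !legal_cons !run_cons /step neq1 neq2.
  by rewrite (ltnW rlt) (ltnW w).
- by exists [::]; split=> // n; have [] := admissible_legal n admx.
Qed.

Lemma language_prefix u :
  language [set x | admissible a x] u -> exists2 y, admissible a y & u = mkseq y (size u).
Proof.
move=> [x [ax arx] [n uE]]; exists (iter n (@shift_seq M) x).
  split=> m; first by rewrite -iterD.
  by rewrite -iter_shift_reflect -iterD.
by rewrite [LHS]uE; apply: eq_mkseq_in => i _; rewrite iter_shiftE.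
Qed.

(** The filler consists of [w1] leading to the hub, a loop [t], and [v] preparing the entry of [x].
    Only [t] varies with [n]. *)
Lemma specification u x :
  language [set x | admissible a x] u -> admissible a x ->
  exists N, forall n, N <= n ->
    exists2 w, size w = n & admissible a (word_cat (u ++ w) x).
Proof.
move=> /language_prefix[y ady uE] adx.
have [k [L [reach loops ready]]] := hub.
have [v [lv lrv lx lrx]] := ready x adx.
have [w1 [lw1 rw1 rrw1]] : exists w, [/\ legal2 a (u ++ w), run a 0 (u ++ w) = 0 &
    run a 0 (reflect_word (u ++ w)) = k].
  suff [w [lw rw rrw r0]] : exists w, [/\ legal2 a (u ++ w),
      run a 0 (u ++ w) <= ~~ wide, run a 0 (reflect_word (u ++ w)) <= ~~ wide &
      run a 0 (u ++ w) = 0 \/ run a 0 (reflect_word (u ++ w)) = 0].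
    have [w2 [lw2 rw2 rrw2]] := reach _ lw rw rrw r0.
    by exists (w ++ w2); rewrite catA.
  have [m um ym] := eventually_reset y (size u).
  have [w0 wE] : exists w0, mkseq y m = u ++ w0.
    exists (mkseq (fun i => y (size u + i)) (m - size u)).
    by rewrite -[in LHS](subnKC um) mkseqD -uE.
  have lw0 : legal2 a (u ++ w0).
    have [lm lrm] := admissible_legal m ady.
    by rewrite -wE /legal2 lm reflect_word_mkseq lrm.
  case: ym => ym.
    have [|w [lw rw rrw]] := descend_all lw0; first by rewrite -wE.
    by exists (w0 ++ w); rewrite catA lw rw rrw; split=> //; left.
  (* If the lower counter is the one that vanished, the descent is applied to the reflected word and
     reflected back. *)
  have [||w [lw rw rrw]] := @descend_all (reflect_word (u ++ w0)).
  - by rewrite legal2_reflect.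
  - by rewrite -wE reflect_word_mkseq.
  rewrite -[w]reflect_wordK -reflect_word_cat ?legal2_reflect ?reflect_wordK in lw rw rrw.
  exists (w0 ++ reflect_word w); rewrite catA lw rw rrw; split=> //; by right.
exists (size w1 + L + size v) => n nN.
have [t st /and4P[lt /eqP rt lrt /eqP rrt]] := loops (n - (size w1 + size v)) ltac:(lia).
exists (w1 ++ t ++ v); first by rewrite !size_cat st; lia.
rewrite catA; move: (u ++ w1) lw1 rw1 rrw1 => z /andP[lz lrz] rz rrz.
apply: word_cat_admissible.
- rewrite /legal2 !reflect_word_cat !legal_cat.
  by rewrite rz rrz rt rrt lz lrz lt lrt lv lrv.
- by move=> i; rewrite !run_cat rz rt.
- by move=> i; rewrite !reflect_word_cat !run_cat rrz rrt.
Qed.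

Lemma admissible_mixing : topologically_mixing [set x | admissible a x].
Proof.
move=> u v Lu Lv; have [x adx vE] := language_prefix Lv.
have [N spec] := specification Lu adx; exists N => n /spec[w sw adw].
have E : u ++ w ++ v = mkseq (word_cat (u ++ w) x) (size (u ++ w ++ v)).
  rewrite catA [in RHS]size_cat mkseqD; congr (_ ++ _).
    rewrite -[LHS](mkseq_nth ord0); apply: eq_mkseq_in => i il.
    by rewrite /word_cat il.
  rewrite vE size_mkseq; apply: eq_mkseq_in => i _.
  by rewrite /word_cat ltnNge leq_addr /= addKn.
exists w; split=> //; last by exists (word_cat (u ++ w) x) => //; exists 0.
exists (word_cat (u ++ w) x) => //; exists (size u).
rewrite -[LHS](mkseq_nth ord0); apply: eq_mkseq_in => i il.
by rewrite /word_cat size_cat ltn_add2l il nth_cat ltnNge leq_addr /= addKn.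
Qed.

End Irreducible.

(** * Closedness, shift invariance and the conclusion *)

Lemma cylinder_nbhs (M : nat) (x : Sigma M) n :
  nbhs x [set y : Sigma M | forall i, i < n -> y i = x i].
Proof.
elim: n => [|n IH]; first by apply: filterS filterT => y _ i.
have px : nbhs x [set y : Sigma M | y n = x n].
  have := @proj_continuous nat (fun=> discrete_topology 'I_M.+1) n x.
  move=> /(_ [set x n]) H; apply: H.
  exact: discrete_set1.
apply: filterS2 IH px => y yx yn i; rewrite ltnS leq_eqVlt => /predU1P[->//|].
exact: yx.
Qed.

(** Legality constrains finite prefixes only, and these are locally constant in the product
    topology; hence closedness. *)
Lemma admissible_subshift (M : nat) (a : Sigma M) : dominates a a ->
  subshift [set x | admissible a x].
Proof.
move=> aa; split.
  move=> x clx; split; apply/(dominatesP _ aa) => n;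
    have [y [[ay ary] eqxy]] := clx _ (cylinder_nbhs x n).
    by rewrite -(eq_mkseq_in eqxy); apply: (dominatesP _ aa).1.
  rewrite -reflect_word_mkseq -(eq_mkseq_in eqxy) reflect_word_mkseq.
  exact: (dominatesP _ aa).1.
move=> _ [x [ax arx] <-]; split=> n.
  by have := ax n.+1; rewrite iterSr.
by have := arx n.+1; rewrite iterSr.
Qed.

Local Open Scope ring_scope.

Theorem proposition3p10 (R : realType) (M : nat) (q : R)
    (hqI : calI M q) (hqU : Ubar M q) :
  subshift (boldVq M q) /\ topologically_mixing (boldVq M q).
Proof.
have [[_ Va] irr] := hqI; have [_ strict] := hqU.
have -> : boldVq M q = [set x | admissible (alpha M q) x].
  by apply/seteqP; split=> x /dominates_pairP.
split; first by apply: admissible_subshift; case/dominates_pairP: Va.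
(* A shift equal to the reflection would contradict the strict lower bound in [Ubar]. *)
apply: admissible_mixing => // n /esym E.
by have := strict n; rewrite E ltxx.
Qed.
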